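(* Let $n\ge2$ and $m$ be natural numbers with $1\le m\le n/2$. Let $A_1,\dots,A_n$ be the vertices of an $\{n/m\}$ star-polygon, numbered consecutively along its circumscribed circle, which has centre $O$ and radius $r$, and let $M$ be the intersection point of the secants $A_1A_{m+1}$ and $A_mA_{2m}$. Then $$P(n,m):=\frac{MA_{m+1}}{A_1A_{m+1}}=\frac{\sin(\pi/n)}{2\cos\big((m-1)\pi/n\big)\,\sin(m\pi/n)} .$$ In particular, $P(n,m)$ does not depend on the diameter of the circumscribed circle.
   Context: The points $A_1,\dots,A_n$ divide the circle into $n$ equal arcs, and the edges of the $\{n/m\}$ star-polygon are the segments joining $A_k$ to $A_{k+m}$ (indices mod $n$). The point $M$ lies on the line $OL$, where $L$ is the orthogonal projection of $O$ on $A_mA_{m+1}$; this line is an axis of symmetry of the polygon. $MA_{m+1}$ and $A_1A_{m+1}$ denote lengths of segments. The number $P(n,m)$ is used as the factor by which the star-polygon is scaled with respect to its vertices. *)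

(* Defs.v *)
From Stdlib Require Import Reals.
Open Scope R_scope.

Definition point : Set := (R * R)%type.

Definition length_of_segment (X Y : point) : R :=
  dist_euc (fst X) (snd X) (fst Y) (snd Y).

(* If X = Y, this is the one-point set {X}. *)
Definition line (X Y Z : point) : Prop :=
  exists t : R,
    Z = (fst X + t * (fst Y - fst X), snd X + t * (snd Y - snd X)).

Definition orth_proj (Z X Y L : point) : Prop :=
  line X Y L /\
  (fst Z - fst L) * (fst Y - fst X) + (snd Z - snd L) * (snd Y - snd X) = 0.

(* The vertices are indexed by all of nat: the formula makes [vertex]
   n-periodic, so indices are read mod n and A_1, ..., A_n are [vertex 1], ...,
   [vertex n].  The sign [s] allows both senses of numbering.  The parameter m
   enters only through the edges, which join [vertex k] to [vertex (k + m)];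
   m and n need not be coprime. *)
Record star_polygon (n m : nat) : Type := {
  centre : point;
  radius : R;
  vertex : nat -> point;
  radius_pos : 0 < radius;
  vertex_equal_arcs :
    exists theta s : R, (s = 1 \/ s = -1) /\
      forall k : nat,
        vertex k =
          (fst centre + radius * cos (theta + s * (2 * PI * INR k / INR n)),
           snd centre + radius * sin (theta + s * (2 * PI * INR k / INR n)))
}.

Arguments centre {n m} _.
Arguments radius {n m} _.
Arguments vertex {n m} _ _.

(* The line carrying the edge that joins A_k to A_{k+m}. *)
Definition secant {n m : nat} (S : star_polygon n m) (k : nat) : point -> Prop :=
  line (vertex S k) (vertex S (k + m)).

(* The line OL, L being the orthogonal projection of the centre O on
   A_m A_{m+1}.  For n = 2 one has L = O and this set is {O}, which is also
   where the perpendicular bisector of A_1 A_2 meets the line A_1 A_2. *)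
Definition axis {n m : nat} (S : star_polygon n m) (M : point) : Prop :=
  exists L : point,
    orth_proj (centre S) (vertex S m) (vertex S (m + 1)) L /\
    line (centre S) L M.

(* M is the intersection point of A_1 A_{m+1} and A_m A_{2m}.  For m = 1 the
   two secants are the same line, and M is its point on the axis OL; for m >= 2
   the secants alone determine M. *)
Definition intersection_point {n m : nat} (S : star_polygon n m) (M : point)
  : Prop :=
  secant S 1 M /\ secant S m M /\ (m = 1%nat -> axis S M).

(* The ratio M A_{m+1} / A_1 A_{m+1}. *)
Definition ratio {n m : nat} (S : star_polygon n m) (M : point) : R :=
  length_of_segment M (vertex S (m + 1)) / length_of_segment (vertex S 1) (vertex S (m + 1)).

(* Main.v *)
Require Import Defs.
From Stdlib Require Import Reals Lra Lia.
Open Scope R_scope.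

(** Let [a = PI / n].  In the coordinates with origin [O], unit [r] and first
    axis along the symmetry axis [OL], the vertex [A_k] has polar angle
    [(2 k - 2 m - 1) a].  Hence [A_(m+1) = (c, d)], [A_m = (c, -d)],
    [A_1 = (C, -D)] and [A_(2m) = (C, D)] with [c, d] the cosine and sine of [a]
    and [C, D] those of [(2 m - 1) a].  The secants are mirror images of each
    other in the axis, so they meet on it; for [m = 1] they coincide, and [M] is
    on the axis by choice.  Hence [M] is the point of [A_1 A_(m+1)] with second
    coordinate [0], and the ratio is [d / (d + D)], where
    [d + D = 2 sin (m a) cos ((m - 1) a)]. *)

(** * Similarities of the plane and the notions they preserve *)

Definition frame (o : point) (r b s : R) (z : point) : point :=
  (fst o + r * (fst z * cos b - s * snd z * sin b),
   snd o + r * (fst z * sin b + s * snd z * cos b)).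

(** Inverse similarity: the rotation is undone by its transpose, and a sign [s] is its own
    inverse. *)
Definition unframe (o : point) (r b s : R) (z : point) : point :=
  (((fst z - fst o) * cos b + (snd z - snd o) * sin b) / r,
   s * ((snd z - snd o) * cos b - (fst z - fst o) * sin b) / r).

Lemma cos_sqr_sin_sqr (b : R) : cos b * cos b = 1 - sin b * sin b.
Proof. generalize (sin2_cos2 b); unfold Rsqr; lra. Qed.

Lemma sign_sqr (s : R) : s = 1 \/ s = -1 -> s * s = 1.
Proof. intros [-> | ->]; ring. Qed.

Section Frame.

Variables (o : point) (r b s : R).
Hypotheses (r_pos : 0 < r) (s_sign : s = 1 \/ s = -1).

Let F := frame o r b s.

Lemma frameK (z : point) : unframe o r b s (F z) = z.
Proof.
  destruct z as [x y]; unfold F, unframe, frame; simpl.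
  generalize (cos_sqr_sin_sqr b) (sign_sqr s s_sign); intros Hb Hs.
  f_equal; field_simplify_eq; try lra.
  - replace (cos b ^ 2) with (1 - sin b * sin b) by (rewrite <- Hb; ring); ring.
  - replace (s ^ 2) with 1 by (rewrite <- Hs; ring).
    replace (cos b ^ 2) with (1 - sin b * sin b) by (rewrite <- Hb; ring); ring.
Qed.

Lemma unframeK (z : point) : F (unframe o r b s z) = z.
Proof.
  destruct z as [x y]; unfold F, unframe, frame; simpl.
  generalize (cos_sqr_sin_sqr b) (sign_sqr s s_sign); intros Hb Hs.
  f_equal; field_simplify_eq; try lra;
    replace (s ^ 2) with 1 by (rewrite <- Hs; ring);
    replace (cos b ^ 2) with (1 - sin b * sin b) by (rewrite <- Hb; ring); ring.
Qed.

Lemma frame_inj (z w : point) : F z = F w -> z = w.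
Proof. intros E; rewrite <- (frameK z), <- (frameK w), E; reflexivity. Qed.

Lemma line_frame (p q z : point) : line (F p) (F q) (F z) <-> line p q z.
Proof.
  assert (affine : forall t, F (fst p + t * (fst q - fst p),
                                snd p + t * (snd q - snd p)) =
            (fst (F p) + t * (fst (F q) - fst (F p)),
             snd (F p) + t * (snd (F q) - snd (F p)))).
  { intros t; unfold F, frame; simpl; f_equal; ring. }
  split; intros [t E]; exists t.
  - apply frame_inj; rewrite affine; exact E.
  - rewrite <- affine, E; reflexivity.
Qed.

(** A similarity of ratio [r] multiplies inner products by [r * r], which is nonzero, so
    orthogonality is kept in both directions. *)
Lemma orth_proj_frame (z x y l : point) :
  orth_proj (F z) (F x) (F y) (F l) <-> orth_proj z x y l.
Proof.
  unfold orth_proj; rewrite line_frame.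
  assert (E : (fst (F z) - fst (F l)) * (fst (F y) - fst (F x)) +
              (snd (F z) - snd (F l)) * (snd (F y) - snd (F x)) =
              r * r * ((fst z - fst l) * (fst y - fst x) +
                       (snd z - snd l) * (snd y - snd x))).
  { unfold F, frame; simpl.
    generalize (cos_sqr_sin_sqr b); intros Hb.
    destruct s_sign as [-> | ->]; ring_simplify;
      replace (cos b ^ 2) with (1 - sin b * sin b) by (rewrite <- Hb; ring); ring. }
  rewrite E; split; intros [Hl H]; split; try exact Hl.
  - apply Rmult_integral in H; destruct H as [H | H]; [exfalso; nra | exact H].
  - rewrite H; ring.
Qed.

End Frame.

(** * Lengths, and the two configurations of secants in axis coordinates *)

Lemma length_of_subsegment (X Y : point) (t : R) :
  length_of_segment (fst X + t * (fst Y - fst X), snd X + t * (snd Y - snd X)) Y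
  = Rabs (1 - t) * length_of_segment X Y.
Proof.
  unfold length_of_segment, dist_euc; simpl.
  rewrite <- sqrt_Rsqr_abs, <- sqrt_mult_alt by apply Rle_0_sqr.
  f_equal; unfold Rsqr; ring.
Qed.

Lemma length_of_segment_neq_0 (X Y : point) : X <> Y -> length_of_segment X Y <> 0.
Proof.
  intros neq H; apply neq.
  unfold length_of_segment, dist_euc in H; apply sqrt_eq_0 in H.
  - apply Rplus_sqr_eq_0 in H.
    destruct X, Y; simpl in H; f_equal; lra.
  - generalize (Rle_0_sqr (fst X - fst Y)) (Rle_0_sqr (snd X - snd Y)); lra.
Qed.

Lemma mirror_secants_meet (c d C D : R) (z : point) :
  0 < d + D -> c <> C ->
  (line (C, - D) (c, d) z /\ line (c, - d) (C, D) z) <->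
  z = (C + D / (d + D) * (c - C), 0).
Proof.
  intros dD cC; split.
  - intros [[t E] [t' E']]; simpl in *; rewrite E in E'; injection E' as E1 E2.
    (* First coordinates force [t' = 1 - t], as the mirror symmetry suggests; second coordinates
       then determine [t]. *)
    assert (T : (c - C) * (t + t' - 1) = 0) by lra.
    apply Rmult_integral in T; destruct T as [T | T]; [lra |].
    assert (Ht : t * (d + D) = D).
    { replace t' with (1 - t) in E2 by lra; lra. }
    rewrite E; replace t with (D / (d + D)) by (rewrite <- Ht at 1; field; lra).
    f_equal; field; lra.
  - intros ->; split; [exists (D / (d + D)) | exists (d / (d + D))]; simpl;
      f_equal; field; lra.
Qed.

(** The foot of the perpendicular from the origin is the midpoint of the side. The case [c = 0],
    which arises for [n = 2], is included: the axis then shrinks to that midpoint. *)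
Lemma side_meets_axis (c d : R) (z : point) :
  0 < d ->
  (line (c, - d) (c, d) z /\
   exists l, orth_proj (0, 0) (c, - d) (c, d) l /\ line (0, 0) l z) <->
  z = (c, 0).
Proof.
  intros Hd; split.
  - intros [[t E] [l [[[t' El] H] [u Ez]]]]; simpl in *; subst l; simpl in *.
    assert (Ht' : t' = / 2).
    (* This is the orthogonality condition; the side is vertical, so only second coordinates
       contribute. *)
    { assert (K : (d * d) * (2 * (1 - 2 * t')) = 0) by (rewrite <- H; ring).
      apply Rmult_integral in K; destruct K as [K | K]; [nra | lra]. }
    subst t'; rewrite E in Ez |- *; injection Ez as E1 E2.
    f_equal; [ring | rewrite E2; field].
  - intros ->; split.
    + exists (/ 2); simpl; f_equal; field.
    + exists (c, 0); repeat split; simpl.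
      * exists (/ 2); simpl; f_equal; field.
      * ring.
      * exists 1; simpl; f_equal; ring.
Qed.

Lemma sin_plus_sin (x y : R) :
  sin x + sin y = 2 * (cos ((y - x) / 2) * sin ((y + x) / 2)).
Proof.
  replace (sin x) with (sin ((y + x) / 2 - (y - x) / 2)) by (f_equal; field).
  replace (sin y) with (sin ((y + x) / 2 + (y - x) / 2)) by (f_equal; field).
  rewrite sin_minus, sin_plus; ring.
Qed.

(** * The star-polygon in axis coordinates *)

Section StarPolygon.

Variables n m : nat.
Hypotheses (n_ge2 : (2 <= n)%nat) (m_ge1 : (1 <= m)%nat) (m_le : (2 * m <= n)%nat).

Let a := PI / INR n.
Let e := (2 * INR m - 1) * a.

Lemma INR_bounds : 2 <= INR n /\ 1 <= INR m /\ 2 * INR m <= INR n.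
Proof.
  repeat split; [change 2 with (INR 2) | change 1 with (INR 1) | ].
  1, 2: apply le_INR; assumption.
  change 2 with (INR 2); rewrite <- mult_INR; apply le_INR; assumption.
Qed.

Lemma half_arc_bounds : 0 < a /\ INR m * a <= PI / 2.
Proof.
  generalize INR_bounds PI_RGT_0; intros [Hn [Hm Hmn]] Hpi.
  assert (Ha : 0 < a) by (apply Rdiv_lt_0_compat; lra).
  assert (E : INR n * a = PI) by (unfold a; field; lra).
  split; nra.
Qed.

Lemma sin_half_arc_pos : 0 < sin a.
Proof.
  generalize INR_bounds half_arc_bounds PI_RGT_0; intros [Hn [Hm Hmn]] [Ha Hma] Hpi.
  apply sin_gt_0; nra.
Qed.

Lemma sin_plus_sin_arcs :
  sin a + sin e = 2 * (cos ((INR m - 1) * a) * sin (INR m * a)).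
Proof.
  rewrite sin_plus_sin; unfold e; do 3 f_equal; field.
Qed.

(** Both factors of the product form are positive: [0 < m a <= PI / 2] and
    [0 <= (m - 1) a < PI / 2]. *)
Lemma sin_plus_sin_arcs_pos : 0 < sin a + sin e.
Proof.
  generalize INR_bounds half_arc_bounds PI_RGT_0; intros [Hn [Hm Hmn]] [Ha Hma] Hpi.
  rewrite sin_plus_sin_arcs.
  apply Rmult_lt_0_compat; [lra | apply Rmult_lt_0_compat].
  - apply cos_gt_0; nra.
  - apply sin_gt_0; nra.
Qed.

(** For [m >= 2] one has [0 < a < e < PI], where the cosine is strictly decreasing. *)
Lemma cos_arcs_neq : m <> 1%nat -> cos a <> cos e.
Proof.
  generalize INR_bounds half_arc_bounds PI_RGT_0; intros [Hn [Hm Hmn]] [Ha Hma] Hpi Hm1.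
  assert (Hm2 : 2 <= INR m) by (change 2 with (INR 2); apply le_INR; lia).
  assert (cos e < cos a); [| lra].
  apply cos_decreasing_1; unfold e; nra.
Qed.

(** The angle [x] is tied to [k] by an equation so that each use can choose its form, such as [- e]
    for the first vertex. *)
Lemma star_polygon_frame (S : star_polygon n m) :
  exists b s, (s = 1 \/ s = -1) /\
    forall k x, x = (2 * INR k - 2 * INR m - 1) * a ->
      vertex S k = frame (centre S) (radius S) b s (cos x, sin x).
Proof.
  destruct INR_bounds as [Hn _].
  destruct (vertex_equal_arcs n m S) as [theta [s [Hs H]]].
  (* Direction of the midpoint of the arc from A_m to A_(m+1), that is, index [m + 1/2]. *)
  set (b := theta + s * ((2 * INR m + 1) * a)).
  exists b, s; split; [exact Hs |].
  intros k x Hx; rewrite H; unfold frame; simpl.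
  replace (theta + s * (2 * PI * INR k / INR n)) with (b + s * x)
    by (rewrite Hx; unfold b, a; field; lra).
  rewrite cos_plus, sin_plus.
  assert (E : cos (s * x) = cos x /\ sin (s * x) = s * sin x).
  { destruct Hs as [-> | ->].
    - rewrite Rmult_1_l; split; ring.
    - replace (-1 * x) with (- x) by ring.
      rewrite cos_neg, sin_neg; split; ring. }
  destruct E as [-> ->]; f_equal; ring.
Qed.

(** The equivalence yields existence and uniqueness together, and the parameter [t] on the first
    secant gives the ratio. *)
Lemma intersection_point_iff (S : star_polygon n m) (M : point) :
  intersection_point S M <->
  let X := vertex S 1 in let Y := vertex S (m + 1) in
  let t := sin e / (sin a + sin e) in
  M = (fst X + t * (fst Y - fst X), snd X + t * (snd Y - snd X)).
Proof.
  destruct (star_polygon_frame S) as [b [s [Hs H]]].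
  generalize (radius_pos n m S); intros Hr.
  generalize sin_plus_sin_arcs_pos sin_half_arc_pos; intros Hde Hd.
  assert (V1 : vertex S 1 = frame (centre S) (radius S) b s (cos e, - sin e)).
  { rewrite <- cos_neg, <- sin_neg; apply H; unfold e; simpl; ring. }
  assert (V2 : vertex S (m + 1) = frame (centre S) (radius S) b s (cos a, sin a)).
  { apply H; rewrite plus_INR; simpl; ring. }
  assert (V3 : vertex S m = frame (centre S) (radius S) b s (cos a, - sin a)).
  { rewrite <- cos_neg, <- sin_neg; apply H; ring. }
  assert (V4 : vertex S (m + m) = frame (centre S) (radius S) b s (cos e, sin e)).
  { apply H; rewrite plus_INR; unfold e; ring. }
  assert (O0 : centre S = frame (centre S) (radius S) b s (0, 0)).
  { rewrite (surjective_pairing (centre S)) at 1; unfold frame; simpl; f_equal; ring. }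
  rewrite <- (unframeK (centre S) (radius S) b s Hr Hs M).
  set (z := unframe _ _ _ _ M).
  assert (frame_iff : intersection_point S (frame (centre S) (radius S) b s z) <->
            z = (cos e + sin e / (sin a + sin e) * (cos a - cos e), 0)).
  { unfold intersection_point, secant, axis.
    rewrite (Nat.add_comm 1 m), V1, V2, V3, V4.
    rewrite !line_frame by assumption.
    destruct (Nat.eq_dec m 1) as [m1 | m1].
    - assert (ea : e = a) by (unfold e; rewrite m1; simpl; ring).
      rewrite ea.
      replace (cos a + _) with (cos a) by ring.
      rewrite <- (side_meets_axis (cos a) (sin a) z Hd).
      split.
      + intros [Hz [_ Hax]]; split; [exact Hz |].
        destruct (Hax m1) as [l [Hl Hlz]].
        (* The foot [l] is an arbitrary point of the plane, so it is first written as the image of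
           its axis coordinates. *)
        rewrite <- (unframeK (centre S) (radius S) b s Hr Hs l) in Hl, Hlz.
        rewrite O0 in Hl at 1; rewrite O0 in Hlz at 1.
        apply orth_proj_frame in Hl; try assumption.
        apply line_frame in Hlz; try assumption.
        exists (unframe (centre S) (radius S) b s l); split; assumption.
      + intros [Hz [l [Hl Hlz]]]; repeat split; try exact Hz.
        intros _; exists (frame (centre S) (radius S) b s l); split.
        * rewrite O0 at 1; apply orth_proj_frame; assumption.
        * rewrite O0 at 1; apply line_frame; assumption.
    (* Here the axis clause is vacuous and the secants are distinct. *)
    - rewrite <- mirror_secants_meet by (auto using cos_arcs_neq).
      tauto. }
  rewrite frame_iff; cbv zeta; rewrite V1, V2.
  (* A similarity is affine, so the image of [w] has the same parameter on the segment between the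
     images of the endpoints. *)
  set (w := (cos e + _, 0)).
  replace (_, _) with (frame (centre S) (radius S) b s w).
  - split; [intros ->; reflexivity | apply frame_inj; assumption].
  - unfold w, frame; simpl; f_equal; field; lra.
Qed.

(** In axis coordinates the heights are [- sin e] and [sin a], whose difference is nonzero. This
    allows cancelling the length in the ratio. *)
Lemma vertex_1_neq_vertex_succ (S : star_polygon n m) : vertex S 1 <> vertex S (m + 1).
Proof.
  destruct (star_polygon_frame S) as [b [s [Hs H]]].
  rewrite (H 1%nat (- e)) by (unfold e; simpl; ring).
  rewrite (H (m + 1)%nat a) by (rewrite plus_INR; simpl; ring).
  intros E; apply frame_inj in E; [| apply radius_pos | exact Hs].
  injection E as _ E; rewrite sin_neg in E.
  generalize sin_plus_sin_arcs_pos; lra.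
Qed.

Lemma ratio_intersection_point (S : star_polygon n m) (M : point) :
  intersection_point S M ->
  ratio S M =
    sin (PI / INR n) /
    (2 * cos ((INR m - 1) * PI / INR n) * sin (INR m * PI / INR n)).
Proof.
  generalize sin_plus_sin_arcs_pos sin_half_arc_pos; intros Hde Hd.
  intros ->%intersection_point_iff; unfold ratio; cbv zeta.
  rewrite length_of_subsegment.
  replace (1 - sin e / (sin a + sin e)) with (sin a / (sin a + sin e)) by (field; lra).
  rewrite Rabs_right by (left; apply Rdiv_lt_0_compat; lra).
  unfold Rdiv at 1; rewrite Rmult_assoc, Rinv_r, Rmult_1_r
    by (apply length_of_segment_neq_0, vertex_1_neq_vertex_succ).
  rewrite sin_plus_sin_arcs; unfold a; unfold Rdiv; rewrite <- !Rmult_assoc; reflexivity.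
Qed.

End StarPolygon.

Theorem mainTheorem4 :
  forall n m : nat, (2 <= n)%nat -> (1 <= m)%nat -> (2 * m <= n)%nat ->
    (forall S : star_polygon n m, exists! M : point, intersection_point S M) /\
    (forall (S : star_polygon n m) (M : point),
       intersection_point S M ->
       ratio S M =
         sin (PI / INR n) /
         (2 * cos ((INR m - 1) * PI / INR n) * sin (INR m * PI / INR n))) /\
    (forall (S S' : star_polygon n m) (M M' : point),
       intersection_point S M -> intersection_point S' M' ->
       ratio S M = ratio S' M').
Proof.
  intros n m n_ge2 m_ge1 m_le; repeat split.
  - intros S; eexists; split.
    + apply intersection_point_iff; auto; reflexivity.
    + intros M HM; apply intersection_point_iff in HM; auto.
  - intros S M; apply ratio_intersection_point; assumption.
  (* Both ratios equal one expression in [n] and [m] alone. *)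
  - intros S S' M M' HM HM'.
    rewrite (ratio_intersection_point n m n_ge2 m_ge1 m_le S M HM).
    rewrite (ratio_intersection_point n m n_ge2 m_ge1 m_le S' M' HM').
    reflexivity.
Qed.
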